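(* Assume the setting described in the context. Let $\rho(\mu):=\min_{a\in A^-}I_{a^*,a}(\hat L_a(a))$. Then under both general and binary contracts, $$C^{\mathrm{SB}}_n(\mu,a^*,u,c)-C^{\mathrm{FB}}(u,c,a^* )=\exp[-\rho(\mu)n+o(n)],\qquad C^{\mathrm{bin}}_n(\mu,a^*,u,c)-C^{\mathrm{FB}}(u,c,a^* )=\exp[-\rho(\mu)n+o(n)].$$
   Context: Finite action set $A$, target $a^*\in A$. A measurable signal space $Z$ with a $\sigma$-finite measure $\nu$. A sequence $\mu=(\mu^n)_n$ of monitoring technologies: for each $n$ and $a\in A$, $\mu^n_a$ is a probability measure on $Z$, absolutely continuous w.r.t. $\nu$ with density $g^n_a$. For $a'\in A\setminus\{a^*\}$, the score $L_n(a')=\frac1n\log\frac{g^n_{a^*}(z)}{g^n_{a'}(z)}$ is well-defined $\mu^n_a$-almost surely for every $a\in A$; $\mathbb{P}_a$ denotes probability under $\mu^n_a$. Large deviations: for each $a\in A$, $a'\neq a^*$ there is $I_{a,a'}:\mathbb{R}\to[0,\infty]$ such that for every measurable $B\subseteq\mathbb{R}$, $-\inf_{\ell\in\mathrm{int}B}I_{a,a'}(\ell)\le\liminf_n\frac1n\log\mathbb{P}_a[L_n(a')\in B]\le\limsup_n\frac1n\log\mathbb{P}_a[L_n(a')\in B]\le-\inf_{\ell\in\mathrm{cl}B}I_{a,a'}(\ell)$. Identification: $I_{a,a'}$ has a unique minimizer $\hat L_a(a')$, and $\hat L_a(a')\neq\hat L_{\tilde a}(a')$ for $a\neq\tilde a$.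 Regularity: each $I_{a,a'}$ has compact level sets, and $I_{a^*,a'}$ is continuous at $\hat L_{a'}(a')$ and at $\hat L_{a^*}(a')$. Payoffs: $\underline w\in\mathbb{R}$; $u:[\underline w,\infty)\to\mathbb{R}$ is $C^2$, $u'>0$, $u''<0$, $\lim_{w\to\infty}u'(w)=0$; $c:A\to\mathbb{R}$ with $c(A)\subseteq\mathrm{int}\,u([\underline w,\infty))$, $c(a^* )>c(a)$ for some $a$ and $c(a^* )\neq c(a)$ for all $a\neq a^*$; outside option $0$; $h=u^{-1}$. A contract $w:Z\to[\underline w,\infty)$ satisfies (IC) if $\int u(w)d\mu^n_{a^*}-c(a^* )\ge\int u(w)d\mu^n_a-c(a)$ for all $a\in A$ and (IR) if $\int u(w)d\mu^n_{a^*}-c(a^* )\ge0$. $C^{\mathrm{SB}}_n(\mu,a^*,u,c)$ is the infimum of $\int w\,d\mu^n_{a^*}$ over contracts satisfying (IC),(IR), and $C^{\mathrm{bin}}_n$ the same over contracts taking exactly two values. First-best cost $C^{\mathrm{FB}}(u,c,a^* )=h(c(a^* ))$. $A^-=\{a:c(a)<c(a^* )\}$. $f(n)=\exp[-rn+o(n)]$ means $\frac1n\log f(n)\to-r$. *)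

(* Defs.v *)
From HB Require Import structures.
From mathcomp Require Import all_boot all_order all_algebra.
From mathcomp Require Import all_classical all_reals all_analysis.
Set Implicit Arguments. Unset Strict Implicit. Unset Printing Implicit Defensive.
Import Order.TTheory GRing.Theory Num.Theory.
Import numFieldNormedType.Exports.
Local Open Scope classical_set_scope.
Local Open Scope ring_scope.

Definition score (R : realType) (Z : Type) (A : Type)
  (g : nat -> A -> Z -> R) (astar : A) (n : nat) (a' : A) (z : Z) : R :=
  n%:R^-1 * ln (g n astar z / g n a' z).

Definition exp_util (R : realType) (d : measure_display) (Z : measurableType d)
  (A : Type) (mu : nat -> A -> probability Z R) (u : R -> R)
  (n : nat) (a : A) (w : Z -> R) : \bar R :=
  (\int[mu n a]_z (u (w z))%:E)%E.

Definition is_contract (R : realType) (d : measure_display) (Z : measurableType d)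
  (wlow : R) (w : Z -> R) : Prop :=
  measurable_fun setT w /\ (forall z, wlow <= w z).

Definition IC (R : realType) (d : measure_display) (Z : measurableType d)
  (A : Type) (mu : nat -> A -> probability Z R) (u : R -> R) (c : A -> R)
  (astar : A) (n : nat) (w : Z -> R) : Prop :=
  forall a : A, (exp_util mu u n a w - (c a)%:E <=
                 exp_util mu u n astar w - (c astar)%:E)%E.

Definition IR (R : realType) (d : measure_display) (Z : measurableType d)
  (A : Type) (mu : nat -> A -> probability Z R) (u : R -> R) (c : A -> R)
  (astar : A) (n : nat) (w : Z -> R) : Prop :=
  (0 <= exp_util mu u n astar w - (c astar)%:E)%E.

Definition binary_contract (R : realType) (Z : Type) (w : Z -> R) : Prop :=
  exists w1 w2 : R, w1 <> w2 /\ range w = [set w1; w2].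

Definition C_SB (R : realType) (d : measure_display) (Z : measurableType d)
  (A : Type) (mu : nat -> A -> probability Z R) (wlow : R) (u : R -> R)
  (c : A -> R) (astar : A) (n : nat) : \bar R :=
  ereal_inf [set (\int[mu n astar]_z (w z)%:E)%E | w in
     [set w : Z -> R | is_contract wlow w /\ IC mu u c astar n w /\ IR mu u c astar n w]].

Definition C_bin (R : realType) (d : measure_display) (Z : measurableType d)
  (A : Type) (mu : nat -> A -> probability Z R) (wlow : R) (u : R -> R)
  (c : A -> R) (astar : A) (n : nat) : \bar R :=
  ereal_inf [set (\int[mu n astar]_z (w z)%:E)%E | w in
     [set w : Z -> R | is_contract wlow w /\ binary_contract w /\
                       IC mu u c astar n w /\ IR mu u c astar n w]].

Definition rho (R : realType) (A : finType) (I : A -> A -> R -> \bar R)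
  (Lhat : A -> A -> R) (c : A -> R) (astar : A) : \bar R :=
  (\big[Order.min/+oo]_(a : A | (c a < c astar)%R) I astar a (Lhat a a))%E.

(* f(n) = exp[-r n + o(n)]  means  (1/n) log f(n) --> -r *)
Definition exp_rate (R : realType) (f : nat -> \bar R) (r : \bar R) : Prop :=
  ((fun n : nat => (n%:R^-1)%:E * lne (f n)) @ \oo --> - r)%E.

(* Main.v *)
(** The score is a log-likelihood ratio, so the law of the signal under [astar]
    is [exp (n * score)] times its law under [a], and under [a] the score
    concentrates at [Lhat a a]. Hence [I astar a (Lhat a a) = - Lhat a a], and
    the rate is [r = min (- Lhat a a)] over the cheaper actions [a].

    Upper bound: pay [wlow] when the score of some cheaper action [a] is at most
    [Lhat a a + e], and slightly more than [wFB] otherwise. The punishment has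
    probability about [exp (- r n)] under [astar] but close to [1] under each
    cheaper action, so a raise of order [exp (- r n)] restores (IR).

    Lower bound: (IC) makes utility fall short of [c astar] by a fixed amount,
    with [a]-probability bounded away from [0], for the minimizing [a]; near
    [Lhat a a] this event keeps [astar]-probability at least
    [exp (- (r + e) n)], and strict concavity of [u] makes it costly. *)
Require Import Defs.
From HB Require Import structures.
From mathcomp Require Import all_boot all_order all_algebra.
From mathcomp Require Import all_classical all_reals all_analysis.
From mathcomp Require Import measurable_realfun lra ring.
Set Implicit Arguments. Unset Strict Implicit. Unset Printing Implicit Defensive.
Import Order.TTheory GRing.Theory Num.Theory.
Import numFieldNormedType.Exports.
Local Open Scope classical_set_scope.
Local Open Scope ring_scope.

(** * Utility *)

Section concave_utility.
Context (R : realType) (wlow : R) (u : R -> R).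
Hypothesis du : forall x, wlow <= x -> derivable u x 1.
Hypothesis ddu : forall x, wlow <= x -> derivable (derive1 u) x 1.
Hypothesis u2 : forall x, wlow <= x -> derive1 (derive1 u) x < 0.

Lemma derivable_MVT (f : R -> R) x y :
  (forall z, wlow <= z -> derivable f z 1) -> wlow <= x -> x < y ->
  exists2 c, x < c < y & f y - f x = derive1 f c * (y - x).
Proof.
move=> df lx xy; have [z||c] := MVT (f := f) (df := derive1 f) xy.
- rewrite in_itv/= => /andP[xz _]; rewrite derive1E; apply/derivableP/df.
  exact: le_trans lx (ltW xz).
- apply: derivable_within_continuous => z; rewrite in_itv/= => /andP[xz _].
  by apply: df; exact: le_trans xz.
- by rewrite in_itv /=; exists c.
Qed.

Lemma derive1_decr x y : wlow <= x -> x < y -> derive1 u y < derive1 u x.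
Proof.
move=> lx xy; have [c /andP[xc cy] e] := derivable_MVT ddu lx xy.
rewrite -subr_lt0 e nmulr_rlt0 ?subr_gt0//; apply: u2.
exact: le_trans lx (ltW xc).
Qed.

(** The mean value theorem turns the chord slope into a derivative between [x] and [y], which
    [derive1_decr] compares with the one at [x]. *)
Lemma concave_tangent x y : wlow <= x -> wlow <= y ->
  u y <= u x + derive1 u x * (y - x).
Proof.
move=> lx ly; rewrite -lerBlDl.
case: (ltgtP x y) => [xy|yx|->]; last by rewrite !subrr mulr0.
- have [c /andP[xc cy] ->] := derivable_MVT du lx xy.
  by rewrite ler_pM2r ?subr_gt0//; apply/ltW/derive1_decr.
- have [c /andP[yc cx] e] := derivable_MVT du ly yx.
  have := derive1_decr (le_trans ly (ltW yc)) cx.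
  nra.
Qed.

Hypothesis u1 : forall x, wlow <= x -> 0 < derive1 u x.

Lemma utility_le x y : wlow <= x -> x <= y -> u x <= u y.
Proof.
rewrite (le_eqVlt x) => lx /predU1P[->//|xy].
have [c /andP[xc cy] e] := derivable_MVT du lx xy.
rewrite -subr_ge0 e mulr_ge0 ?subr_ge0 1?ltW//.
by apply: u1; exact: le_trans lx (ltW xc).
Qed.

Lemma utility_continuous x : wlow <= x -> {for x, continuous u}.
Proof. by move=> /du/derivable1_diffP/differentiable_continuous. Qed.

(** [u] is controlled only on [[wlow, +oo[], so it is composed there, as a function continuous on
    that subspace. *)
Lemma utility_measurable (d : measure_display) (Z : measurableType d)
  (w : Z -> R) : measurable_fun setT w -> (forall z, wlow <= w z) ->
  measurable_fun setT (u \o w).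
Proof.
move=> mw wl; apply: (@measurable_comp _ _ _ _ _ _ `[wlow, +oo[) => //.
- by move=> _ [z _ <-]; rewrite /= in_itv/= wl.
- apply: subspace_continuous_measurable_fun => //.
  apply: derivable_within_continuous => x; rewrite in_itv/= andbT.
  exact: du.
Qed.

(* What the wage [w] costs the principal beyond the certain wage [wFB], utility
   being priced at the marginal rate [1 / u'(wFB)]. *)
Definition agency_loss (wFB w : R) := w - wFB - (u w - u wFB) / derive1 u wFB.

Lemma agency_loss_ge0 wFB w : wlow <= wFB -> wlow <= w -> 0 <= agency_loss wFB w.
Proof.
move=> l0 lw; rewrite subr_ge0 ler_pdivrMr ?u1//.
have := concave_tangent l0 lw; lra.
Qed.

(** The tangent at [w1] bounds [w - w1] and the tangent at [wFB] bounds [w1 - wFB]; as their slopes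
    differ, the loss is at least linear in the shortfall of [u w] below [u w1]. *)
Lemma agency_loss_ge wFB w1 w : wlow <= w1 -> w1 < wFB -> wlow <= w ->
  ((derive1 u wFB)^-1 - (derive1 u w1)^-1) * (u w1 - u w) <= agency_loss wFB w.
Proof.
move=> l1 w10 lw; have l0 := le_trans l1 (ltW w10).
have w1w : (u w - u w1) / derive1 u w1 <= w - w1.
  rewrite ler_pdivrMr ?u1//; have := concave_tangent l1 lw; lra.
have w0w : (u w1 - u wFB) / derive1 u wFB <= w1 - wFB.
  rewrite ler_pdivrMr ?u1//; have := concave_tangent l0 l1; lra.
rewrite /agency_loss; lra.
Qed.

Lemma inv_derive1_incr x y : wlow <= x -> x < y ->
  (derive1 u x)^-1 < (derive1 u y)^-1.
Proof.
move=> lx xy; rewrite ltf_pV2 ?posrE ?u1 ?derive1_decr//.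
exact: le_trans lx (ltW xy).
Qed.

End concave_utility.

(** * Exponential rates *)

Section exponential_rates.
Context {R : realType}.
Implicit Types (x : \bar R) (u f : nat -> \bar R).

Lemma limn_esup_lt u l :
  (limn_esup u < l)%E -> \forall n \near \oo, (u n < l)%E.
Proof.
rewrite /limn_esup limf_esupE => /ereal_inf_lt[_ [V V0 <-] uVl].
apply: filterS V0 => n Vn; apply: le_lt_trans uVl.
by apply: ereal_sup_ubound; exists n.
Qed.

Lemma limn_einf_gt u l :
  (l < limn_einf u)%E -> \forall n \near \oo, (l < u n)%E.
Proof.
rewrite /limn_einf -[l in (l < _)%E]oppeK lteN2 => /limn_esup_lt.
by apply: filterS => n; rewrite lteN2.
Qed.

(** Since [lne] sends nonpositive arguments to [-oo], the equivalence covers every [x]; [0 < n]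
    keeps [n%:R^-1] away from its default [0]. *)
Lemma rate_le n x (y : R) : (0 < n)%N ->
  (((n%:R^-1)%:E * lne x <= y%:E) = (x <= (expR (n%:R * y))%:E))%E.
Proof.
move=> n0; have n0' : (0 < n%:R :> R) by rewrite ltr0n.
rewrite lee_pdivrMl// -EFinM.
case: x => [r| |] //=; last by rewrite !leNye.
rewrite lee_fin; case: ifPn => [r0|]; first by rewrite leNye (le_trans r0)// expR_ge0.
by rewrite -ltNge lee_fin => r0; rewrite -ler_expR lnK.
Qed.

Lemma rate_ge n x (y : R) : (0 < n)%N ->
  ((y%:E <= (n%:R^-1)%:E * lne x) = ((expR (n%:R * y))%:E <= x))%E.
Proof.
move=> n0; have n0' : (0 < n%:R :> R) by rewrite ltr0n.
rewrite lee_pdivlMl// -EFinM.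
case: x => [r| |] //=; last by rewrite !leey.
rewrite lee_fin; case: ifPn => [r0|].
  by rewrite leeNy_eq/= leNgt (le_lt_trans r0)// expR_gt0.
by rewrite -ltNge lee_fin => r0; rewrite -[in RHS]ler_ln ?posrE ?expR_gt0// expRK.
Qed.

Lemma near_constant_le_expR (K e : R) : 0 < e ->
  \forall n \near \oo, K <= expR (n%:R * e).
Proof.
move=> e0; near=> n.
apply: (@le_trans _ _ (1 + n%:R * e)); last exact: expR_ge1Dx.
rewrite -lerBlDl -ler_pdivrMr//; near: n; exact: nbhs_infty_ger.
Unshelve. all: by end_near. Qed.

(** Each bound is taken at [e / 2]; the other half of the slack absorbs the constant [K]. *)
Lemma exp_rate_squeeze f (r : R) :
  (forall e, 0 < e -> exists K, \forall n \near \oo,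
     (f n <= (K * expR (n%:R * (- r + e)))%:E)%E) ->
  (forall e, 0 < e -> exists2 K, 0 < K & \forall n \near \oo,
     ((K * expR (n%:R * (- r - e)))%:E <= f n)%E) ->
  exp_rate f r%:E.
Proof.
move=> fle fge; rewrite /exp_rate -EFinN.
have up (e : R) : 0 < e -> \forall n \near \oo,
    ((n%:R^-1)%:E * lne (f n) <= (- r + e)%:E)%E.
  move=> e0; have e20 : 0 < e / 2 by lra.
  have [K fK] := fle _ e20; near=> n.
  have n0 : (0 < n)%N by near: n; exact: nbhs_infty_gt.
  rewrite rate_le//; apply: (@le_trans _ _ (K * expR (n%:R * (- r + e / 2)))%:E).
    by near: n.
  have -> : n%:R * (- r + e) = n%:R * (e / 2) + n%:R * (- r + e / 2) by lra.
  rewrite lee_fin expRD ler_wpM2r ?expR_ge0//.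
  by near: n; exact: near_constant_le_expR.
have lo (e : R) : 0 < e -> \forall n \near \oo,
    ((- r - e)%:E <= (n%:R^-1)%:E * lne (f n))%E.
  move=> e0; have e20 : 0 < e / 2 by lra.
  have [K K0 fK] := fge _ e20; near=> n.
  have n0 : (0 < n)%N by near: n; exact: nbhs_infty_gt.
  rewrite rate_ge//; apply: (@le_trans _ _ (K * expR (n%:R * (- r - e / 2)))%:E); last by near: n.
  have -> : n%:R * (- r - e) = n%:R * (- r - e / 2) - n%:R * (e / 2) by lra.
  rewrite lee_fin expRD mulrC ler_wpM2r ?expR_ge0// expRN.
  rewrite -[leRHS]invrK lef_pV2 ?posrE ?invr_gt0 ?expR_gt0//.
  by near: n; exact: near_constant_le_expR.
have fin : \forall n \near \oo, ((n%:R^-1)%:E * lne (f n))%E \is a fin_num.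
  near=> n; rewrite fin_numElt; apply/andP; split.
    apply: (@lt_le_trans _ _ (- r - 1)%:E); rewrite ?ltNyr//.
    by near: n; exact: lo.
  apply: (@le_lt_trans _ _ (- r + 1)%:E); rewrite ?ltry//.
  by near: n; exact: up.
apply/fine_cvgP; split => //.
apply/cvgrPdist_le => e e0; near=> n; rewrite /=.
have fn : ((n%:R^-1)%:E * lne (f n))%E \is a fin_num by near: n.
rewrite distrC ler_distl -!lee_fin fineK//; apply/andP; split.
  by near: n; exact: lo.
by near: n; exact: up.
Unshelve. all: by end_near. Qed.

End exponential_rates.

(** If the infimum were [0], points of [F] with rate at most [1 / (k + 1)] would, inside a compact
    level set, cluster at a point of [F] of rate [0]; that point is a minimizer, hence [xm]. *)
Lemma rate_inf_gt0 (R : realType) (J : R -> \bar R) (xm : R) (F : set R) :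
  (forall x, 0 <= J x)%E ->
  (forall alpha : R, compact [set x | (J x <= alpha%:E)%E]) ->
  (forall x, (forall y, (J x <= J y)%E) -> x = xm) ->
  closed F -> ~ F xm ->
  exists2 eta : R, 0 < eta & (eta%:E <= ereal_inf (J @` F))%E.
Proof.
move=> J0 cJ Jmin cF Fxm; apply: contrapT => noeta.
have small k : exists x, F x /\ (J x <= (k.+1%:R^-1)%:E)%E.
  apply: contrapT => nox; apply: noeta; exists (k.+1%:R^-1); first by rewrite invr_gt0.
  apply: le_ereal_inf_tmp => _ [x Fx <-]; apply: ltW; rewrite ltNge.
  by apply/negP => Jx; apply: nox; exists x.
have [x xF] := choice small.
have xclose k m : (k <= m)%N -> (J (x m) <= (k.+1%:R^-1)%:E)%E.
  move=> km; have [_ /le_trans->//] := xF m.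
  by rewrite lee_fin lef_pV2 ?posrE// ler_nat ltnS.
have [] := cJ 1 (x @ \oo).
  by exists 0%N => // m _ /=; have := @xclose 0%N m isT; rewrite invr1.
move=> p [_ clp].
have pclosed (C : set R) : closed C -> (x @ \oo) C -> C p.
  by move=> cC xC; apply: cC => V Vp; exact: clp.
have Fp : F p by apply: pclosed => //; exists 0%N => // m _ /=; have [] := xF m.
(* Level sets are closed because they are compact; this does the work of lower semicontinuity. *)
have Jp k : (J p <= (k.+1%:R^-1)%:E)%E.
  apply: (pclosed [set y | (J y <= (k.+1%:R^-1)%:E)%E]).
    by apply: compact_closed => //; exact: Rhausdorff.
  by exists k => // m km; exact: xclose.
apply: Fxm; rewrite -(Jmin p) // => y; apply: le_trans (J0 y).
apply/lee_addgt0Pr => e e0; rewrite add0e.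
have [k ke] : exists k : nat, k.+1%:R^-1 < e.
  have [k _ H] := near_infty_natSinv_lt (PosNum e0).
  by exists k; apply: (H k) => /=.
by apply: le_trans (Jp k) _; rewrite lee_fin ltW.
Qed.

(** * Likelihood ratios and scores *)

Lemma measurable_inv (R : realType) : measurable_fun setT (@GRing.inv R).
Proof.
rewrite -(setUv [set 0]); apply/measurable_funU => //; first exact: measurableC.
split; first exact: measurable_fun_set1.
apply: open_continuous_measurable_fun.
  by apply: closed_openC; exact: closed_eq.
by move=> x; rewrite inE /= => /eqP; exact: inv_continuous.
Qed.

Section change_of_measure.
Context (R : realType) (d : measure_display) (Z : measurableType d).
Context (nu : {measure set Z -> \bar R}) (A : Type) (astar : A).
Context (mu : nat -> A -> probability Z R) (g : nat -> A -> Z -> R).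
Hypothesis mg : forall n a, measurable_fun setT (g n a).
Hypothesis g_ge0 : forall n a z, 0 <= g n a z.
Hypothesis mu_density : forall n a (B : set Z), measurable B ->
  mu n a B = (\int[nu]_(z in B) (g n a z)%:E)%E.
Hypothesis score_def : forall n a a', a' <> astar ->
  {ae mu n a, forall z, 0 < g n astar z /\ 0 < g n a' z}.

Lemma measurable_score n a : measurable_fun setT (score g astar n a).
Proof.
apply: measurable_funM => //.
apply: (measurableT_comp (@measurable_ln R)); apply: measurable_funM => //.
exact: (measurableT_comp (@measurable_inv R)).
Qed.

Lemma density_le n a a' (K : R) (B : set Z) : measurable B -> 0 <= K ->
  (forall z, B z -> g n a z <= K * g n a' z) ->
  (mu n a B <= K%:E * mu n a' B)%E.
Proof.
move=> mB K0 gK.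
have mgB b : measurable_fun B (EFin \o g n b).
  by apply/measurable_EFinP; exact: measurable_funTS.
rewrite !mu_density// -ge0_integralZl//; last 2 first.
- exact: mgB.
- by move=> z _; rewrite lee_fin.
apply: ge0_le_integral => //.
- by move=> z _; rewrite lee_fin.
- exact: mgB.
- exact: (measurable_funeM K%:E (mgB a')).
Qed.

(** Off this set the division or [ln] in [score] takes a default value. For [a <> astar],
    [score_def] makes its complement null under every action, so events may be cut down to it. *)
Let good n a := [set z | 0 < g n astar z] `&` [set z | 0 < g n a z].

Let mgood n a : measurable (good n a).
Proof.
have m b : measurable [set z | 0 < g n b z].
  have -> : [set z | 0 < g n b z] = g n b @^-1` `]0, +oo[.
    by apply/seteqP; split=> z /=; rewrite in_itv/= andbT.
  by rewrite -[X in measurable X]setTI; exact: mg.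
exact: measurableI.
Qed.

Let mu_good n b a (B : set Z) : a <> astar -> measurable B ->
  mu n b B = mu n b (B `&` good n a).
Proof.
move=> aas mB; have mBg : measurable (B `\` good n a) by exact: measurableD.
have null : mu n b (B `\` good n a) = 0%E.
  apply: measure_negligible => //.
  by apply: negligibleS (score_def n b aas) => z /= [_].
by rewrite -[RHS]add0e -null; exact: measureDI.
Qed.

Let score_density n a z : (0 < n)%N -> good n a z ->
  g n astar z = expR (n%:R * score g astar n a z) * g n a z.
Proof.
move=> n0 [/= gs ga]; rewrite /score mulrA divff ?pnatr_eq0 -?lt0n// mul1r.
by rewrite lnK ?posrE ?divr_gt0// divfK// gt_eqF.
Qed.

(** Change of measure: on [good n a] the likelihood ratio of [astar] to [a] is
    [expR (n%:R * score)], here at most [expR (n%:R * l)]. *)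
Lemma mu_astar_le n a (l : R) (B : set Z) : (0 < n)%N -> a <> astar ->
  measurable B -> (forall z, B z -> score g astar n a z <= l) ->
  (mu n astar B <= (expR (n%:R * l))%:E * mu n a B)%E.
Proof.
move=> n0 aas mB sl; rewrite !(mu_good n _ aas mB).
apply: density_le => [||z [Bz gz]]; [exact: measurableI|exact: expR_ge0|].
by rewrite (score_density n0 gz) ler_wpM2r// ler_expR ler_wpM2l ?sl.
Qed.

Lemma mu_astar_ge n a (l : R) (B : set Z) : (0 < n)%N -> a <> astar ->
  measurable B -> (forall z, B z -> l <= score g astar n a z) ->
  ((expR (n%:R * l))%:E * mu n a B <= mu n astar B)%E.
Proof.
move=> n0 aas mB sl; rewrite !(mu_good n _ aas mB).
rewrite -lee_pdivlMl ?expR_gt0//; apply: density_le => [||z [Bz gz]].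
- exact: measurableI.
- by rewrite invr_ge0 expR_ge0.
- rewrite (score_density n0 gz) mulrA ler_peMl// -expRN -expRD.
  by rewrite -[leLHS]expR0 ler_expR addrC -mulrBr mulr_ge0// subr_ge0 sl.
Qed.

End change_of_measure.

(** * Large deviations of the score *)

Section score_asymptotics.
Context (R : realType) (d : measure_display) (Z : measurableType d).
Context (nu : {measure set Z -> \bar R}) (A : finType) (astar : A).
Context (mu : nat -> A -> probability Z R) (g : nat -> A -> Z -> R).
Context (I : A -> A -> R -> \bar R) (Lhat : A -> A -> R).
Hypothesis mg : forall n a, measurable_fun setT (g n a).
Hypothesis g_ge0 : forall n a z, 0 <= g n a z.
Hypothesis mu_density : forall n a (B : set Z), measurable B ->
  mu n a B = (\int[nu]_(z in B) (g n a z)%:E)%E.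
Hypothesis score_def : forall n a a', a' <> astar ->
  {ae mu n a, forall z, 0 < g n astar z /\ 0 < g n a' z}.
Hypothesis I_ge0 : forall a a' x, (0 <= I a a' x)%E.
Hypothesis LDP_lower : forall a a', a' <> astar ->
  forall B : set R, measurable B ->
  (- ereal_inf (I a a' @` interior B) <=
   limn_einf (fun n : nat =>
     (n%:R^-1)%:E * lne (mu n a (score g astar n a' @^-1` B))))%E.
Hypothesis LDP_upper : forall a a', a' <> astar ->
  forall B : set R, measurable B ->
  (limn_esup (fun n : nat =>
     (n%:R^-1)%:E * lne (mu n a (score g astar n a' @^-1` B)))
   <= - ereal_inf (I a a' @` closure B))%E.
Hypothesis I_argmin : forall a a', a' <> astar ->
  forall x, (forall y, (I a a' x <= I a a' y)%E) -> x = Lhat a a'.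
Hypothesis I_level : forall a a', a' <> astar -> forall alpha : R,
  compact [set x | (I a a' x <= alpha%:E)%E].

Let msc n a (B : set R) : measurable B -> measurable (score g astar n a @^-1` B).
Proof. by move=> mB; rewrite -[X in measurable X]setTI; exact: measurable_score. Qed.

(** Off an open interval around the minimizer the rate function is bounded below by some [eta > 0],
    so the large deviation upper bound makes the complement exponentially unlikely. *)
Lemma score_concentration a (e delta : R) : a <> astar -> 0 < e -> 0 < delta ->
  \forall n \near \oo, ((1 - delta)%:E <=
    mu n a (score g astar n a @^-1` `[(Lhat a a - e)%R, (Lhat a a + e)%R]))%E.
Proof.
move=> aas e0 d0; pose F := ~` [set` `](Lhat a a - e), (Lhat a a + e)[].
have cF : closed F by apply: open_closedC; exact: interval_open.
have mF := closed_measurable cF.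
have [|eta eta0 etaF] := rate_inf_gt0 (I_ge0 a a) (@I_level a a aas) (@I_argmin a a aas) cF.
  by apply; rewrite /= in_itv/=; lra.
have up := @LDP_upper a a aas _ mF.
(* Halving [eta] gives a strict inequality, which then holds for all large [n]. *)
have {}up : (limn_esup (fun n : nat => (n%:R^-1)%:E *
    lne (mu n a (score g astar n a @^-1` F))) < (- (eta / 2))%:E)%E.
  apply: (le_lt_trans up); rewrite -(proj1 (closure_id F) cF) lteNl -EFinN opprK.
  by apply: lt_le_trans etaF; rewrite lte_fin; lra.
have eta20 : 0 < eta / 2 by lra.
near=> n.
have n0 : (0 < n)%N by near: n; exact: nbhs_infty_gt.
have Fd : (mu n a (score g astar n a @^-1` F) <= delta%:E)%E.
  apply: (@le_trans _ _ (expR (n%:R * - (eta / 2)))%:E).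
    by rewrite -rate_le//; apply: ltW; near: n; exact: limn_esup_lt.
  rewrite lee_fin mulrN expRN -[leRHS]invrK lef_pV2 ?posrE ?invr_gt0 ?expR_gt0//.
  by near: n; exact: near_constant_le_expR.
apply: (@le_trans _ _ (mu n a (~` (score g astar n a @^-1` F)))).
  by rewrite probability_setC ?EFinB ?leeB//; exact: msc.
apply: le_measure; rewrite ?inE.
- exact/measurableC/msc.
- exact: msc.
- by move=> z /= /contrapT; rewrite !in_itv/= => /andP[/ltW-> /ltW->].
Unshelve. all: by end_near. Qed.

(** For an event of scores near [Lhat a a], change of measure gives [astar]-probability about
    [exp (n * Lhat a a)], and large deviations give about [exp (- n * I astar a (Lhat a a))]. A
    strict inequality between the exponents is refuted on a small interval. *)
Lemma rate_at_Lhat a : a <> astar -> {for Lhat a a, continuous (I astar a)} ->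
  I astar a (Lhat a a) = (- Lhat a a)%:E.
Proof.
move=> aas Icont; apply/eqP; rewrite eq_le; apply/andP; split.
- rewrite leNgt; apply/negP => LI.
  have [alpha La aI] : exists2 alpha : R, - Lhat a a < alpha & (alpha%:E < I astar a (Lhat a a))%E.
    move: LI; case: (I astar a (Lhat a a)) => [r| |]//.
    + by rewrite lte_fin => Lr; exists ((r - Lhat a a) / 2); rewrite ?lte_fin; lra.
    + by move=> _; exists (1 - Lhat a a); rewrite ?ltry//; lra.
  have /nbhs_ballP[e /= e0 eI] : nbhs (Lhat a a) [set x | (alpha%:E < I astar a x)%E].
    by apply: (Icont [set y | (alpha%:E < y)%E]); apply: open_nbhs_nbhs; split => //;
      exact: open_ereal_gt_ereal.
  (* Here [- alpha = Lhat a a - 2 * t]. As [e' <= t / 2], the lower bound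
     [exp (n * (Lhat a a - e')) / 2] from change of measure eventually reaches
     [exp (n * (Lhat a a - t))], against large deviations; [e' < e] keeps the closed interval in the
     ball. *)
  pose t := (alpha + Lhat a a) / 2; have t0 : 0 < t by rewrite /t; lra.
  pose e' := Num.min (e / 2) (t / 2).
  have e'0 : 0 < e' by rewrite lt_min; apply/andP; split; rewrite divr_gt0.
  have e'e : e' < e by rewrite gt_min; apply/orP; left; lra.
  have e't : e' <= t / 2 by rewrite ge_min lexx orbT.
  pose B := [set` `[(Lhat a a - e'), (Lhat a a + e')]].
  have up := @LDP_upper astar a aas _ (measurable_itv `[(Lhat a a - e'), (Lhat a a + e')]).
  have {}up : (limn_esup (fun n : nat => (n%:R^-1)%:E *
      lne (mu n astar (score g astar n a @^-1` B))) < (Lhat a a - t)%:E)%E.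
    apply: (le_lt_trans up).
    have cB : closed B by exact: interval_closed.
    rewrite -(proj1 (closure_id B) cB).
    apply: (@le_lt_trans _ _ (- alpha)%:E); last by rewrite lte_fin /t; lra.
    rewrite EFinN leeN2; apply: le_ereal_inf_tmp => _ [x /= + <-].
    rewrite /B/= in_itv/= => /andP[x1 x2]; apply/ltW/eI.
    by rewrite /ball/= ltr_norml; apply/andP; split; lra.
  have t20 : 0 < t / 2 by lra.
  have half : 0 < 2^-1 :> R by lra.
  near \oo => n.
  have n0 : (0 < n)%N by near: n; exact: nbhs_infty_gt.
  have : ((n%:R^-1)%:E * lne (mu n astar (score g astar n a @^-1` B)) < (Lhat a a - t)%:E)%E.
    by near: n; exact: limn_esup_lt.
  apply/negP; rewrite -leNgt rate_ge//.
  apply: le_trans (mu_astar_ge mg g_ge0 mu_density score_def (l := Lhat a a - e') n0 aas _ _).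
  + apply: (@le_trans _ _ ((expR (n%:R * (Lhat a a - e')))%:E * (1 - 2^-1)%:E)%E).
      have -> : n%:R * (Lhat a a - t) = n%:R * (Lhat a a - e') - n%:R * (t - e') by lra.
      rewrite lee_fin expRD ler_wpM2l ?expR_ge0//.
      rewrite (_ : 1 - 2^-1 = 2^-1); last by lra.
      rewrite expRN lef_pV2 ?posrE ?expR_gt0//.
      apply: (@le_trans _ _ (expR (n%:R * (t / 2)))).
        by near: n; exact: near_constant_le_expR.
      by rewrite ler_expR ler_wpM2l//; lra.
    rewrite lee_pmul2l ?lte_fin ?expR_gt0//.
    by near: n; exact: score_concentration.
  + by apply: msc; exact: measurable_itv.
  + by move=> z; rewrite /B/= in_itv/= => /andP[].
- rewrite leNgt; apply/negP => LI.
  have [r Ir] : exists r, I astar a (Lhat a a) = r%:E.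
    move: LI (I_ge0 astar a (Lhat a a)).
    by case: (I astar a (Lhat a a)) => [r| |]//; exists r.
  move: LI; rewrite Ir lte_fin => LI.
  (* Now [- r = Lhat a a + 2 * e], so the large deviation lower bound exceeds the cap
     [exp (n * (Lhat a a + e))] from change of measure. *)
  pose e := (- Lhat a a - r) / 2; have e0 : 0 < e by rewrite /e; lra.
  pose B := [set` `](Lhat a a - e), (Lhat a a + e)[].
  have lo := @LDP_lower astar a aas _ (measurable_itv `](Lhat a a - e), (Lhat a a + e)[).
  have {}lo : ((Lhat a a + e)%:E < limn_einf (fun n : nat => (n%:R^-1)%:E *
      lne (mu n astar (score g astar n a @^-1` B))))%E.
    apply: lt_le_trans lo.
    rewrite (proj1 (interior_id _) (@interval_open _ _ _ _ _)) //.
    apply: (@lt_le_trans _ _ (- r)%:E); first by rewrite lte_fin /e; lra.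
    rewrite EFinN leeN2 -Ir; apply: ereal_inf_lbound; exists (Lhat a a) => //=.
    by rewrite in_itv/=; lra.
  near \oo => n.
  have n0 : (0 < n)%N by near: n; exact: nbhs_infty_gt.
  have : ((Lhat a a + e)%:E < (n%:R^-1)%:E * lne (mu n astar (score g astar n a @^-1` B)))%E.
    by near: n; exact: limn_einf_gt.
  apply/negP; rewrite -leNgt rate_le//.
  apply: (le_trans (mu_astar_le mg g_ge0 mu_density score_def (l := Lhat a a + e) n0 aas _ _)).
  + by apply: msc; exact: measurable_itv.
  + by move=> z; rewrite /B/= in_itv/= => /andP[_ /ltW].
  + by rewrite -[leRHS]mule1 lee_pmul2l ?lte_fin ?expR_gt0// probability_le1//;
      apply: msc; exact: measurable_itv.
Unshelve. all: by end_near. Qed.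

(** [S n] is the union over [T] of the events that the score of [a] is at most [Lhat a a + e].
    Concentration makes it likely under each [a] in [T]; change of measure and a union bound make it
    rare under [astar]. *)
Lemma detection_sets (T : pred A) (r e : R) :
  (forall a, T a -> a <> astar) -> (forall a, T a -> Lhat a a <= - r) -> 0 < e ->
  exists S : nat -> set Z, [/\ forall n, measurable (S n),
    forall n, (0 < n)%N ->
      (mu n astar (S n) <= (#|T|%:R * expR (n%:R * (- r + e)))%:E)%E &
    forall a delta, T a -> 0 < delta ->
      \forall n \near \oo, ((1 - delta)%:E <= mu n a (S n))%E].
Proof.
move=> Tas Tr e0.
pose V n a := score g astar n a @^-1` `]-oo, (Lhat a a + e)].
have mV n a : measurable (V n a) by apply: msc; exact: measurable_itv.
exists (fun n => \big[setU/set0]_(a | T a) V n a); split.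
- by move=> n; exact: bigsetU_measurable.
- move=> n n0.
  have -> : #|T|%:R * expR (n%:R * (- r + e)) = \sum_(a | T a) expR (n%:R * (- r + e)).
    by rewrite sumr_const mulr_natl.
  rewrite -sumEFin.
  elim: (index_enum A) => [|a s ih]; first by rewrite !big_nil measure0.
  rewrite !big_cons; case: ifPn => // Ta.
  apply: (le_trans (measureU2 _ (mV n a) _)); first exact: bigsetU_measurable.
  apply: leeD ih.
  apply: (le_trans (mu_astar_le mg g_ge0 mu_density score_def
    (l := Lhat a a + e) n0 (Tas a Ta) (mV n a) _)).
    by move=> z; rewrite /V/= in_itv.
  apply: (@le_trans _ _ (expR (n%:R * (Lhat a a + e)))%:E).
    by rewrite -[leRHS]mule1 lee_pmul2l ?lte_fin ?expR_gt0// probability_le1.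
  by rewrite lee_fin ler_expR ler_wpM2l// lerD2r Tr.
- move=> a delta Ta d0; have := score_concentration (Tas _ Ta) e0 d0.
  apply: filterS => n /le_trans; apply; apply: le_measure; rewrite ?inE.
  + exact: msc.
  + exact: bigsetU_measurable.
  + rewrite (bigD1 a)//=; apply: subset_trans (@subsetUl _ _ _) => z /=.
    by rewrite /V/= !in_itv/= => /andP[].
Qed.

End score_asymptotics.

(** * Costs of contracts *)

Section expectations.
Context (R : realType) (d : measure_display) (Z : measurableType d).
Context (P : probability Z R).
Implicit Types f h : Z -> R.

(** Positive and negative parts are compared separately, so infinite expectations are covered. *)
Lemma le_integral_measurable f h :
  measurable_fun setT f -> measurable_fun setT h -> (forall z, f z <= h z) ->
  (\int[P]_z (f z)%:E <= \int[P]_z (h z)%:E)%E.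
Proof.
move=> /measurable_EFinP mf /measurable_EFinP mh fh.
rewrite integralE [leRHS]integralE leeB//; apply: ge0_le_integral => //.
- exact: measurable_funepos.
- exact: measurable_funepos.
- by move=> z _; rewrite !funeposE ge_max !le_max lee_fin fh lexx orbT.
- exact: measurable_funeneg.
- exact: measurable_funeneg.
- by move=> z _; rewrite !funenegE ge_max !le_max leeN2 lee_fin fh lexx orbT.
Qed.

(** The negative part is at most [|m|], hence of finite integral, so a finite expectation bounds the
    positive part too. *)
Lemma integrable_bounded_below f (m : R) :
  measurable_fun setT f -> (forall z, m <= f z) ->
  (\int[P]_z (f z)%:E < +oo)%E -> P.-integrable setT (EFin \o f).
Proof.
move=> mf fm foo; have mfE : measurable_fun setT (EFin \o f) by exact/measurable_EFinP.
have neg_fin : (\int[P]_z ((EFin \o f)^\- z) < +oo)%E.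
  apply: (@le_lt_trans _ _ (\int[P]_z (cst `|m|%:E z))%E).
    apply: ge0_le_integral => //; first exact: measurable_funeneg.
    move=> z _; rewrite funenegE /= ge_max !lee_fin normr_ge0 andbT.
    by have := fm z; have := ler_norm (- m); rewrite normrN; lra.
  by rewrite integral_cst//= probability_setT mule1 ltry.
apply/integrableP; split => //.
rewrite (_ : (fun z => `|_|%E) = (EFin \o f)^\+ \+ (EFin \o f)^\-)%E; last exact: fune_abse.
rewrite ge0_integralD//; last 2 first.
- exact: measurable_funepos.
- exact: measurable_funeneg.
rewrite lte_add_pinfty//; move: foo; rewrite [X in (X < _)%E -> _]integralE.
case: (\int[P]_x ((EFin \o f)^\+ x))%E => [r _| |] //; first exact: ltry.
by move: neg_fin; case: (\int[P]_x ((EFin \o f)^\- x))%E.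
Qed.

Lemma integrable_indicZ (k : R) (S : set Z) : measurable S ->
  P.-integrable setT (fun z => (k * \1_S z)%:E).
Proof.
move=> mS; under eq_fun do rewrite EFinM.
by apply: integrableZl => //; exact: integrable_indic.
Qed.

Lemma integral_indicZ (k : R) (S : set Z) : measurable S ->
  (\int[P]_z (k * \1_S z)%:E)%E = (k * fine (P S))%:E.
Proof.
move=> mS; under eq_integral do rewrite EFinM.
rewrite integralZl//; last exact: integrable_indic.
by rewrite integral_indic// setIT EFinM fineK// fin_num_measure.
Qed.

Lemma integral_two_level (x y : R) (S : set Z) : measurable S ->
  (\int[P]_z (y + (x - y) * \1_S z)%:E)%E = (y + (x - y) * fine (P S))%:E.
Proof.
move=> mS; under eq_integral do rewrite EFinD.
rewrite integralD//; last 2 first.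
- exact: finite_measure_integrable_cst.
- exact: integrable_indicZ.
by rewrite integral_indicZ// integral_cst//= probability_setT mule1 EFinD.
Qed.

Lemma measurable_two_level (x y : R) (S : set Z) : measurable S ->
  measurable_fun setT (fun z => y + (x - y) * \1_S z).
Proof. by move=> mS; apply: measurable_funD => //; apply: measurable_funM. Qed.

(** [f] dominates the function equal to [v] where [f <= t] and to [t] elsewhere. *)
Lemma expectation_ge f (v t : R) : measurable_fun setT f ->
  (forall z, v <= f z) ->
  ((t + (v - t) * fine (P (f @^-1` `]-oo, t])))%:E <= \int[P]_z (f z)%:E)%E.
Proof.
move=> mf vf; have mS : measurable (f @^-1` `]-oo, t]).
  by rewrite -[X in measurable X]setTI; exact: mf.
rewrite -integral_two_level//; apply: le_integral_measurable => //.
  exact: measurable_two_level.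
move=> z; rewrite indicE; case: (boolP (z \in _)) => [_|]; first by rewrite mulr1 addrC subrK.
by rewrite mulr0 addr0 notin_setE /= in_itv/= => /negP; rewrite -ltNge => /ltW.
Qed.

End expectations.

(** * Lower and upper bounds on the cost of a contract *)

Section contract_costs.
Context (R : realType) (d : measure_display) (Z : measurableType d).
Context (A : finType) (astar : A) (mu : nat -> A -> probability Z R).
Context (wlow : R) (u : R -> R) (c : A -> R) (wFB : R).
Hypothesis du : forall x, wlow <= x -> derivable u x 1.
Hypothesis ddu : forall x, wlow <= x -> derivable (derive1 u) x 1.
Hypothesis u1 : forall x, wlow <= x -> 0 < derive1 u x.
Hypothesis u2 : forall x, wlow <= x -> derive1 (derive1 u) x < 0.
Hypothesis c_int : forall a, interior (u @` [set w | wlow <= w]) (c a).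
Hypothesis wlow_wFB : wlow <= wFB.
Hypothesis u_wFB : u wFB = c astar.

(** As [c a] is interior to the range of [u], some admissible wage has utility below [c a], and
    [wlow] has no more. *)
Lemma utility_wlow_lt a : u wlow < c a.
Proof.
have /nbhs_ballP[e /= e0 eu] := c_int a.
have [|x /= lx ux] := eu (c a - e / 2).
  by rewrite /ball/= opprB addrC subrK gtr0_norm; lra.
by apply: le_lt_trans (utility_le du u1 (lexx _) lx) _; rewrite ux; lra.
Qed.

(* Write [D := c astar - c a]. Unless (IR) is slack by [D / 2], which is itself
   costly, (IC) forces the utility below [c astar - D / 4] with [a]-probability
   at least [2 * delta]; there the agency loss is at least [kap], and the
   likelihood-ratio bound [kappa] on [G] carries this event over to [astar]. *)
Lemma agency_cost_ge a : c a < c astar ->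
  exists beta delta, [/\ 0 < beta, 0 < delta &
    forall n (G : set Z) (kappa : R) (w : Z -> R),
      measurable G -> 0 <= kappa <= 1 ->
      (forall B, measurable B -> B `<=` G ->
        (kappa%:E * mu n a B <= mu n astar B)%E) ->
      ((1 - delta)%:E <= mu n a G)%E ->
      is_contract wlow w -> IC mu u c astar n w -> IR mu u c astar n w ->
      ((wFB + beta * kappa)%:E <= \int[mu n astar]_z (w z)%:E)%E].
Proof.
move=> caas; pose D := c astar - c a; have D0 : 0 < D by rewrite subr_gt0.
pose t := c astar - D / 4.
have lca := utility_wlow_lt a.
have lowFB : wlow < wFB.
  rewrite lt_neqAle wlow_wFB andbT; apply/eqP => e.
  by have := utility_wlow_lt astar; rewrite e u_wFB ltxx.
have [w1 /andP[lw1 w1FB] tw1] : exists2 w1, wlow <= w1 < wFB & t < u w1.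
  have : \forall x \near wFB^'-, t < u x.
    apply: (cvgr_gt (c astar)); last by rewrite /t; lra.
    by rewrite -u_wFB; apply: cvg_at_left_filter; exact: (utility_continuous du wlow_wFB).
  move=> near_t; near wFB^'- => w1; exists w1; last by near: w1.
  by apply/andP; split; near: w1; [exact: nbhs_left_ge|exact: nbhs_left_lt].
pose k := (derive1 u wFB)^-1; have k0 : 0 < k by rewrite invr_gt0 u1.
(* The bound of [agency_loss_ge] at utility [t]: every wage worth at most [t] loses at least this
   much. *)
pose kap := (k - (derive1 u w1)^-1) * (u w1 - t).
have kap0 : 0 < kap by rewrite mulr_gt0 ?subr_gt0//; exact: (inv_derive1_incr ddu u2 u1).
pose M := c astar - u wlow; have M0 : 0 < M by rewrite /M; lra.
pose delta := D / (8 * M); have delta0 : 0 < delta by rewrite divr_gt0// mulr_gt0.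
have b0 : 0 < Num.min (k * (D / 2)) (kap * delta).
  by rewrite lt_min; apply/andP; split; apply: mulr_gt0 => //; lra.
exists (Num.min (k * (D / 2)) (kap * delta)), delta; split => //.
move=> n G kappa w mG /andP[kappa0 kappa1] kmu mGd [mw wl] ic ir.
have muw : measurable_fun setT (u \o w) by exact: (utility_measurable du).
have [woo|] := ltP (\int[mu n astar]_z (w z)%:E)%E +oo%E; last first.
  by apply: le_trans; rewrite leey.
have iw := integrable_bounded_below mw wl woo.
have ul z : u wlow <= u (w z) by exact: (utility_le du u1).
have prE b B : measurable B -> mu n b B = (fine (mu n b B))%:E.
  by move=> mB; rewrite fineK// fin_num_measure.
(* Utility lies below its tangent at [wFB], an affine function of the integrable wage. *)
have iuw : (mu n astar).-integrable setT (EFin \o (u \o w)).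
  apply: (integrable_bounded_below muw ul).
  pose h z := (u wFB - derive1 u wFB * wFB) + derive1 u wFB * w z.
  have ih : (mu n astar).-integrable setT (EFin \o h).
    rewrite (_ : EFin \o h = (EFin \o cst (u wFB - derive1 u wFB * wFB)%R) \+
      (fun z => (derive1 u wFB)%:E * (EFin \o w) z))%E//.
    apply: integrableD => //; first exact: finite_measure_integrable_cst.
    exact: integrableZl.
  apply: le_lt_trans (integrable_lty measurableT ih).
  apply: le_integral_measurable => //.
    by apply: measurable_funD => //; exact: measurable_funM.
  move=> z; have := concave_tangent du ddu u2 wlow_wFB (wl z).
  by rewrite /h /=; lra.
pose r := fine (\int[mu n astar]_z (u (w z))%:E)%E.
have rE : (\int[mu n astar]_z (u (w z))%:E)%E = r%:E.
  by rewrite fineK//; exact: (integrable_fin_num measurableT iuw).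
have ikuw : (mu n astar).-integrable setT (fun z => (k * u (w z))%:E).
  by under eq_fun do rewrite EFinM; exact: (integrableZl measurableT k iuw).
have kuE : (\int[mu n astar]_z (k * u (w z))%:E)%E = (k * r)%:E.
  by under eq_integral do rewrite EFinM; rewrite integralZl// rE.
pose S := (u \o w) @^-1` `]-oo, t].
have mS : measurable S by rewrite -[X in measurable X]setTI; exact: muw.
(* Integrates the pointwise bound [wFB + k * (u w - c astar) + kap * \1_S <= w]. *)
have loss : ((wFB + k * (r - c astar) + kap * fine (mu n astar S))%:E <=
    \int[mu n astar]_z (w z)%:E)%E.
  have -> : ((wFB + k * (r - c astar) + kap * fine (mu n astar S))%:E =
      \int[mu n astar]_z ((wFB - k * c astar)%R + k * u (w z) + kap * \1_S z)%:E)%E.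
    under eq_integral do rewrite 2!EFinD.
    rewrite integralD//; last 2 first.
    - by apply: integrableD => //; exact: finite_measure_integrable_cst.
    - exact: integrable_indicZ.
    rewrite integralD//; last exact: finite_measure_integrable_cst.
    rewrite integral_indicZ// integral_cst//= probability_setT mule1.
    by rewrite kuE -!EFinD; congr EFin; lra.
  apply: le_integral_measurable => //.
    apply: measurable_funD; last exact: measurable_funM.
    by apply: measurable_funD => //; exact: measurable_funM.
  move=> z; have := agency_loss_ge0 du ddu u2 u1 wlow_wFB (wl z).
  have := agency_loss_ge du ddu u2 u1 lw1 w1FB (wl z).
  rewrite /agency_loss -/k u_wFB => loss1 loss0.
  rewrite indicE; case: (boolP (z \in S)) => [|_]; last by rewrite mulr0; lra.
  rewrite inE /S /= in_itv/= => uwt.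
  have : kap <= (k - (derive1 u w1)^-1) * (u w1 - u (w z)).
    by rewrite ler_wpM2l ?lerD2l ?lerN2// subr_ge0 ltW// (inv_derive1_incr ddu u2 u1).
  by rewrite mulr1; lra.
apply: le_trans loss; rewrite lee_fin.
have pS0 : 0 <= fine (mu n astar S) by exact: fine_ge0.
have r0 : 0 <= r - c astar by move: ir; rewrite /IR /exp_util rE -EFinB lee_fin.
have ra : t + (u wlow - t) * fine (mu n a S) - c a <= r - c astar.
  have := ic a; rewrite /exp_util rE -lee_fin !EFinB; apply: le_trans.
  by rewrite leeB//; exact: expectation_ge.
rewrite -addrA lerD2l.
have [rD|rD] := leP (D / 2) (r - c astar).
  apply: (@le_trans _ _ (k * (r - c astar))); last by rewrite lerDl mulr_ge0// ltW.
  apply: (@le_trans _ _ (k * (D / 2))); last by rewrite ler_wpM2l// ltW.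
  by apply: le_trans (ler_piMr (ltW b0) kappa1) _; rewrite ge_min lexx.
apply: (@le_trans _ _ (kap * fine (mu n astar S))); last by rewrite lerDr mulr_ge0// ltW.
apply: (@le_trans _ _ (kap * delta * kappa)).
  by rewrite ler_wpM2r// ge_min lexx orbT.
rewrite -mulrA ler_wpM2l ?(ltW kap0)//.
have pa0 : 0 <= fine (mu n a S) by exact: fine_ge0.
(* By [ra], [3 * D / 4 - (t - u wlow) * P_a(S) < D / 2], and [t - u wlow <= M], so [P_a(S)] is at
   least [D / (4 * M) = 2 * delta]. Missing [G] costs at most [delta] of it. *)
have paS : 2 * delta <= fine (mu n a S).
  have -> : 2 * delta = D / 4 / M by rewrite /delta; field; lra.
  rewrite ler_pdivrMr//.
  have : (t - u wlow) * fine (mu n a S) <= M * fine (mu n a S).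
    by rewrite ler_wpM2r// /M /t; lra.
  rewrite -[u wlow - t]opprB mulNr in ra; have DE : D = c astar - c a by [].
  have tE : t = c astar - D / 4 by [].
  rewrite [_ * M]mulrC; lra.
have mSG : measurable (S `&` G) by exact: measurableI.
have paSG : delta <= fine (mu n a (S `&` G)).
  have : (mu n a S <= mu n a (~` G) + mu n a (S `&` G))%E.
    rewrite [leLHS](measureDI _ mS mG) leeD2r//; apply: le_measure; rewrite ?inE.
    - exact: measurableD.
    - exact: measurableC.
    - by move=> z [].
  rewrite probability_setC// (prE a S)// (prE a (S `&` G))// (prE a G)//.
  move: mGd; rewrite (prE a G)// lee_fin -EFinB -EFinD lee_fin; lra.
have := kmu _ mSG (@subIsetr _ _ _).
have : (mu n astar (S `&` G) <= mu n astar S)%E.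
  by apply: le_measure; rewrite ?inE//; exact: subIsetl.
rewrite (prE a (S `&` G))// (prE astar (S `&` G))// (prE astar S)// -EFinM !lee_fin.
have : kappa * delta <= kappa * fine (mu n a (S `&` G)) by rewrite ler_wpM2l.
lra.
Unshelve. all: by end_near. Qed.

(* By concavity a raise [K * p], at most [1], is worth at least
   [2 * (u wFB - u wlow) * p], twice the expected utility taken away by paying
   [wlow] on [S]. *)
Lemma binary_cost_le n (S : set Z) :
  let K := 2 * (u wFB - u wlow) / derive1 u (wFB + 1) in
  let p := fine (mu n astar S) in
  measurable S -> S !=set0 -> ~` S !=set0 -> p <= 2^-1 -> K * p <= 1 ->
  (forall a, a <> astar ->
    u (wFB + K * p) + (u wlow - u (wFB + K * p)) * fine (mu n a S) <= c a) ->
  (C_bin mu wlow u c astar n <= (wFB + K * p)%:E)%E.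
Proof.
move=> K p mS [z1 Sz1] [z0 Sz0] p12 Kp1 uc; set wh := wFB + K * p.
have l1 : wlow <= wFB + 1 by move: wlow_wFB; lra.
have M0 : 0 < u wFB - u wlow by rewrite u_wFB subr_gt0 utility_wlow_lt.
have K0 : 0 < K by rewrite divr_gt0 ?mulr_gt0 ?u1.
have p0 : 0 <= p by exact: fine_ge0.
have Kp0 : 0 <= K * p by rewrite mulr_ge0// ltW.
have lwh : wlow <= wh by move: wlow_wFB; rewrite /wh; lra.
have uwh : u wFB + 2 * (u wFB - u wlow) * p <= u wh.
  have := concave_tangent du ddu u2 lwh wlow_wFB.
  have -> : wFB - wh = - (K * p) by rewrite /wh; lra.
  have s1 : derive1 u (wFB + 1) <= derive1 u wh.
    have [->//|ne] := eqVneq wh (wFB + 1).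
    apply/ltW/(derive1_decr ddu u2 lwh); rewrite lt_neqAle ne/= /wh; lra.
  have : derive1 u (wFB + 1) * (K * p) <= derive1 u wh * (K * p) by rewrite ler_wpM2r.
  have -> : derive1 u (wFB + 1) * (K * p) = 2 * (u wFB - u wlow) * p.
    by rewrite /K; field; rewrite gt_eqF ?u1.
  lra.
pose w z := wh + (wlow - wh) * \1_S z.
have w_in z : S z -> w z = wlow by move=> Sz; rewrite /w indicE mem_set// mulr1 addrC subrK.
have w_out z : ~ S z -> w z = wh by move=> Sz; rewrite /w indicE memNset// mulr0 addr0.
have whl : wlow <> wh.
  move=> e; move: uwh; rewrite -e; have : 0 <= 2 * (u wFB - u wlow) * p.
    by rewrite mulr_ge0// mulr_ge0// ltW.
  lra.
have utilE a : exp_util mu u n a w =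
    (u wh + (u wlow - u wh) * fine (mu n a S))%:E.
  rewrite -integral_two_level//; apply: eq_integral => z _; congr EFin.
  have [Sz|Sz] := pselect (S z).
    by rewrite w_in// indicE mem_set// mulr1 addrC subrK.
  by rewrite w_out// indicE memNset// mulr0 addr0.
(* The slack is at least [p * (u wFB - u wlow) * (1 - 2 * p)], which is where [p <= 1 / 2]
   enters. *)
have ir : 0 <= u wh + (u wlow - u wh) * p - c astar.
  have : 0 <= p * (u wFB - u wlow) * (1 - 2 * p).
    by rewrite !mulr_ge0// ?(ltW M0)//; lra.
  have : (1 - p) * (u wFB + 2 * (u wFB - u wlow) * p) <= (1 - p) * u wh.
    by rewrite ler_wpM2l//; lra.
  rewrite -u_wFB; lra.
apply: (@le_trans _ _ (\int[mu n astar]_z (w z)%:E)%E); last first.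
  by rewrite integral_two_level// lee_fin -/p gerDl mulr_le0_ge0// subr_le0.
apply: ereal_inf_lbound; exists w => //; split; last split.
- split; first exact: measurable_two_level.
  move=> z; have [/w_in->//|/w_out->//] := pselect (S z).
- exists wlow, wh; split => //; apply/seteqP; split.
    move=> _ [z _ <-]; have [/w_in->|/w_out->] := pselect (S z); [by left|by right].
  by move=> _ [->|->]; [exists z1 => //; exact: w_in|exists z0 => //; exact: w_out].
- rewrite /IC /IR utilE -/p; split; last by rewrite -EFinB lee_fin.
  move=> a; rewrite utilE -!EFinB lee_fin.
  have [->//|aas] := pselect (a = astar).
  by apply: le_trans ir; rewrite subr_le0; exact: uc.
Unshelve. all: by end_near. Qed.

End contract_costs.

(** * The exponential rate of the agency cost *)

Theorem theorem4 (R : realType) (d : measure_display) (Z : measurableType d)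
  (nu : {measure set Z -> \bar R})
  (A : finType) (astar : A)
  (mu : nat -> A -> probability Z R) (g : nat -> A -> Z -> R)
  (I : A -> A -> R -> \bar R) (Lhat : A -> A -> R)
  (wlow : R) (u : R -> R) (c : A -> R) (wFB : R)
  (* signal space: sigma-finite reference measure, densities *)
  (Hnu : sigma_finite setT nu)
  (Hg_meas : forall n a, measurable_fun setT (g n a))
  (Hg_ge0 : forall n a z, 0 <= g n a z)
  (Hdens : forall n a (B : set Z), measurable B ->
     mu n a B = (\int[nu]_(z in B) (g n a z)%:E)%E)
  (* the score L_n(a') is well defined mu^n_a-a.s. for every a *)
  (Hscore : forall n a a', a' <> astar ->
     {ae mu n a, forall z, 0 < g n astar z /\ 0 < g n a' z})
  (* large deviations *)
  (HI_ge0 : forall a a' x, (0 <= I a a' x)%E)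
  (HLDP_lower : forall a a', a' <> astar -> forall B : set R, measurable B ->
     (- ereal_inf (I a a' @` interior B) <=
      limn_einf (fun n : nat => (n%:R^-1)%:E * lne (mu n a (score g astar n a' @^-1` B))))%E)
  (HLDP_upper : forall a a', a' <> astar -> forall B : set R, measurable B ->
     (limn_esup (fun n : nat => (n%:R^-1)%:E * lne (mu n a (score g astar n a' @^-1` B)))
      <= - ereal_inf (I a a' @` closure B))%E)
  (* identification *)
  (Hmin : forall a a', a' <> astar ->
     forall x, (I a a' (Lhat a a') <= I a a' x)%E)
  (Hmin_uniq : forall a a', a' <> astar ->
     forall x, (forall y, (I a a' x <= I a a' y)%E) -> x = Lhat a a')
  (Hident : forall a a1 a', a' <> astar -> a <> a1 -> Lhat a a' <> Lhat a1 a')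
  (* regularity *)
  (Hlevel : forall a a', a' <> astar -> forall alpha : R,
     compact [set x | (I a a' x <= alpha%:E)%E])
  (Hcont1 : forall a', a' <> astar -> {for Lhat a' a', continuous (I astar a')})
  (Hcont2 : forall a', a' <> astar -> {for Lhat astar a', continuous (I astar a')})
  (* utility: C^2 on [wlow, oo), u' > 0, u'' < 0, u' -> 0 *)
  (Hu_der : forall x, wlow <= x -> derivable u x 1 /\ derivable (derive1 u) x 1)
  (Hu_C2 : {within [set x | wlow <= x], continuous (derive1 (derive1 u))})
  (Hu_incr : forall x, wlow <= x -> 0 < derive1 u x)
  (Hu_conc : forall x, wlow <= x -> derive1 (derive1 u) x < 0)
  (Hu_lim : derive1 u x @[x --> +oo] --> 0)
  (* costs *)
  (Hc_int : forall a, interior (u @` [set w | wlow <= w]) (c a))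
  (Hc_some : exists a, c a < c astar)
  (Hc_neq : forall a, a <> astar -> c a <> c astar)
  (* first-best cost h(c astar) with h the inverse of u *)
  (HwFB : wlow <= wFB) (HuFB : u wFB = c astar) :
  exp_rate (fun n => (C_SB mu wlow u c astar n - wFB%:E)%E) (rho I Lhat c astar) /\
  exp_rate (fun n => (C_bin mu wlow u c astar n - wFB%:E)%E) (rho I Lhat c astar).
Proof.
have du x : wlow <= x -> derivable u x 1 by case/Hu_der.
have ddu x : wlow <= x -> derivable (derive1 u) x 1 by case/Hu_der.
have lt_neq a : c a < c astar -> a <> astar by move=> + e; rewrite e ltxx.
have rateE a : a <> astar -> I astar a (Lhat a a) = (- Lhat a a)%:E.
  move=> aas; apply: (rate_at_Lhat (Lhat := Lhat) Hg_meas Hg_ge0 Hdens Hscore) => //.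
  exact: Hcont1.
(* If [Lhat a a] were [0], it would have rate [0] under [astar], hence be the minimizer
   [Lhat astar a], against identification. *)
have Lhat_lt0 a : a <> astar -> Lhat a a < 0.
  move=> aas; rewrite -oppr_gt0 lt_neqAle -lee_fin -rateE// HI_ge0 andbT.
  apply/eqP => L0; apply: (Hident a astar a aas aas); apply: Hmin_uniq => // y.
  by rewrite rateE// -L0; exact: HI_ge0.
have [a1 ca1] := Hc_some.
have [a0 + rho0] := eq_bigmin (x := +oo%E) a1 (fun a => c a < c astar)
  (fun a => I astar a (Lhat a a)) ca1 (fun i _ => leey _).
move=> ca0; have {}ca0 : c a0 < c astar by exact: ca0.
have a0as := lt_neq _ ca0.
have rhoE : rho I Lhat c astar = (- Lhat a0 a0)%:E by rewrite /rho rho0 rateE.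
have a0_min a : c a < c astar -> Lhat a a <= Lhat a0 a0.
  move=> ca; rewrite -lerN2 -lee_fin -!rateE//; last exact: lt_neq.
  by rewrite -rho0; exact: bigmin_le_cond.
set r := - Lhat a0 a0; have r0 : 0 < r by rewrite oppr_gt0 Lhat_lt0.
have SB_ge e : 0 < e -> exists2 K, 0 < K & \forall n \near \oo,
    ((K * expR (n%:R * (- r - e)))%:E <= C_SB mu wlow u c astar n - wFB%:E)%E.
  move=> e0.
  have [beta [delta [beta0 delta0 cost]]] :=
    agency_cost_ge mu du ddu Hu_incr Hu_conc Hc_int HwFB HuFB ca0.
  exists beta => //.
  have conc := score_concentration Hg_meas HI_ge0 HLDP_upper Hmin_uniq Hlevel a0as e0 delta0.
  near=> n; have n0 : (0 < n)%N by near: n; exact: nbhs_infty_gt.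
  rewrite leeBrDr// -EFinD addrC; apply: le_ereal_inf_tmp => _ [w [cw [icw irw]] <-].
  (* Here [kappa] is [expR (n%:R * (- r - e))]: on this set the score is at least
     [Lhat a0 a0 - e = - r - e]. *)
  apply: (cost n (score g astar n a0 @^-1` `[Lhat a0 a0 - e, Lhat a0 a0 + e])) => //.
  - by rewrite -[X in measurable X]setTI; exact: measurable_score.
  - rewrite expR_ge0 -[X in _ <= X]expR0 ler_expR mulr_ge0_le0//.
    by rewrite /r opprK; have := Lhat_lt0 _ a0as; lra.
  - move=> B mB BG; apply: (mu_astar_ge Hg_meas Hg_ge0 Hdens Hscore) => //.
    by move=> z /BG /=; rewrite in_itv/= /r opprK => /andP[].
  - by near: n.
have bin_le e : 0 < e -> exists K, \forall n \near \oo,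
    (C_bin mu wlow u c astar n - wFB%:E <= (K * expR (n%:R * (- r + e)))%:E)%E.
  (* Capping [e'] at [r / 2] keeps [- r + e'] negative, so that the punishment probability [p n]
     tends to [0]. *)
  move=> e0; pose e' := Num.min e (r / 2).
  have e'0 : 0 < e' by rewrite lt_min e0 divr_gt0.
  have e'e : e' <= e by rewrite ge_min lexx.
  have e'r : e' <= r / 2 by rewrite ge_min lexx orbT.
  have [S [mS S_small S_large]] : exists S : nat -> set Z, [/\ forall n, measurable (S n),
    forall n, (0 < n)%N ->
      (mu n astar (S n) <= (#|fun a => c a < c astar|%:R * expR (n%:R * (- r + e')))%:E)%E &
    forall a delta, c a < c astar -> 0 < delta ->
      \forall n \near \oo, ((1 - delta)%:E <= mu n a (S n))%E].
    apply: (detection_sets Hg_meas Hg_ge0 Hdens Hscore HI_ge0 HLDP_upper Hmin_uniq Hlevel) => //.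
    by move=> a /a0_min; rewrite /r opprK.
  set N := #|_|%:R in S_small.
  pose p n := fine (mu n astar (S n)); pose q n a := fine (mu n a (S n)).
  have prE n a : mu n a (S n) = (q n a)%:E by rewrite fineK// fin_num_measure.
  have p_le n : (0 < n)%N -> p n <= N * expR (n%:R * (- r + e')).
    by move=> n0; rewrite -lee_fin -prE; exact: S_small.
  have q_ge a delta : c a < c astar -> 0 < delta -> \forall n \near \oo, 1 - delta <= q n a.
    by move=> ca d0; apply: filterS (S_large a delta ca d0) => n; rewrite prE lee_fin.
  have q0 n a : 0 <= q n a by exact: fine_ge0.
  have q1 n a : q n a <= 1 by rewrite -lee_fin -prE probability_le1.
  have p_small eta : 0 < eta -> \forall n \near \oo, p n <= eta.
    move=> eta0; have re0 : 0 < r - e' by lra.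
    near=> n; have n0 : (0 < n)%N by near: n; exact: nbhs_infty_gt.
    apply: le_trans (p_le _ n0) _.
    rewrite (_ : n%:R * (- r + e') = - (n%:R * (r - e'))); last by lra.
    rewrite expRN ler_pdivrMr ?expR_gt0// -ler_pdivrMl// mulrC.
    by near: n; exact: near_constant_le_expR.
  pose K := 2 * (u wFB - u wlow) / derive1 u (wFB + 1).
  have lw1 : wlow <= wFB + 1 by lra.
  have ulow a := utility_wlow_lt du Hu_incr Hc_int a.
  have M0 : 0 < u wFB - u wlow by rewrite HuFB subr_gt0.
  have K0 : 0 < K by rewrite divr_gt0 ?mulr_gt0 ?Hu_incr.
  pose s := derive1 u wFB; have s0 : 0 < s by exact: Hu_incr.
  have sK0 : 0 < s * K by rewrite mulr_gt0.
  have uh n : u (wFB + K * p n) <= c astar + s * K * p n.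
    have Kp0 : 0 <= K * p n by rewrite mulr_ge0 ?fine_ge0// ltW.
    have lwh : wlow <= wFB + K * p n by lra.
    have := concave_tangent du ddu Hu_conc HwFB lwh.
    by rewrite -/s HuFB [wFB + _]addrC addrK mulrA.
  have uh_low n : u wlow <= u (wFB + K * p n).
    apply: (utility_le du Hu_incr) => //.
    by apply: (le_trans HwFB); rewrite lerDl mulr_ge0 ?fine_ge0// ltW.
  exists (K * N).
  (* A cheaper action is punished with probability near [1], which brings its utility close to
     [u wlow < c a]. A costlier one earns at most the raised utility, which tends to
     [c astar < c a]. *)
  have deterred : \forall n \near \oo, forall a, a <> astar ->
      u (wFB + K * p n) + (u wlow - u (wFB + K * p n)) * q n a <= c a.
    apply: filter_forall => a.
    have [->|/eqP aas] := eqVneq a astar; first by near=> n.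
    have [ca|ca|/(Hc_neq _ aas)//] := ltgtP (c a) (c astar).
    (* Once [s * K * p n <= 1], the utility spread is at most [u wFB - u wlow + 1]; this [delta]
       makes its unpunished share at most [c a - u wlow]. *)
    - pose delta := (c a - u wlow) / (u wFB - u wlow + 1).
      have M10 : 0 < u wFB - u wlow + 1 by lra.
      have d0 : 0 < delta by rewrite divr_gt0// subr_gt0.
      have sKV0 : 0 < (s * K)^-1 by rewrite invr_gt0.
      near=> n => _.
      have qd : 1 - q n a <= delta.
        by rewrite lerBlDr -lerBlDl; near: n; exact: q_ge.
      have sKp : s * K * p n <= 1.
        by rewrite -ler_pdivlMl// mulr1; near: n; exact: p_small.
      have : (1 - q n a) * (u (wFB + K * p n) - u wlow) <= delta * (u wFB - u wlow + 1).
        apply: ler_pM => //; rewrite ?subr_ge0//.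
        by rewrite HuFB; have := uh n; lra.
      rewrite /delta divfK ?gt_eqF//; lra.
    - have g0 : 0 < (c a - c astar) / (s * K) by rewrite divr_gt0// subr_gt0.
      near=> n => _.
      have sKp : s * K * p n <= c a - c astar.
        by rewrite mulrC -ler_pdivlMr//; near: n; exact: p_small.
      have : 0 <= (u (wFB + K * p n) - u wlow) * q n a by rewrite mulr_ge0 ?subr_ge0.
      by have := uh n; lra.
  have half : 0 < 2^-1 :> R by lra.
  have KV0 : 0 < K^-1 by rewrite invr_gt0.
  near=> n; have n0 : (0 < n)%N by near: n; exact: nbhs_infty_gt.
  have p12 : p n <= 2^-1 by near: n; exact: p_small.
  have q12 : 1 - 2^-1 <= q n a0 by near: n; exact: q_ge.
  have Kp1 : K * p n <= 1.
    by rewrite -ler_pdivlMl// mulr1; near: n; exact: p_small.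
  rewrite leeBlDr//; apply: (@le_trans _ _ (wFB + K * p n)%:E).
    apply: (binary_cost_le du ddu Hu_incr Hu_conc Hc_int HwFB HuFB (mS n)) => //.
    (* Both wages are really paid: [S n] has [a0]-probability at least [1 / 2], and its complement
       has [astar]-probability at least [1 / 2]. *)
    - apply/set0P/eqP => S0; move: q12; rewrite /q S0 measure0 /=; lra.
    - apply/set0P/eqP => S0; move: p12.
      by rewrite /p -[S n]setCK S0 setC0 probability_setT /=; lra.
    - by near: n.
  rewrite -EFinD lee_fin addrC lerD2r -mulrA ler_pM2l//.
  apply: le_trans (p_le _ n0) _; rewrite ler_wpM2l// ler_expR ler_wpM2l//; lra.
have SB_bin n : (C_SB mu wlow u c astar n <= C_bin mu wlow u c astar n)%E.
  apply: ereal_inf_le_tmp => _ [w [cw [_ icr]] <-]; exists w => //.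
(* Since [C_SB <= C_bin], the upper bound for binary contracts and the lower bound for general ones
   serve both claims. *)
rewrite rhoE; split; apply: exp_rate_squeeze => e e0.
- have [K binK] := bin_le e e0; exists K; apply: filterS binK => n; apply: le_trans.
  by rewrite leeB.
- exact: SB_ge.
- exact: bin_le.
- have [K K0 SBK] := SB_ge e e0; exists K => //; apply: filterS SBK => n /le_trans; apply.
  by rewrite leeB.
Unshelve. all: by end_near. Qed.
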